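(* Let $\mathbb{F}_q$ be a finite field with $q$ elements and let $n\ge 1$. The number of Hankel matrices in $\mathbb{F}_q^{n\times n}$ having full rank is $q^{2n-1}-q^{2n-2}$.
   Context: A Hankel matrix is a matrix constant along its anti-diagonals, i.e. an $n\times n$ matrix $H$ with entries $H_{ij}=a_{i+j-1}$ for $1\le i,j\le n$, for some vector $(a_1,\dots,a_{2n-1})\in\mathbb{F}_q^{2n-1}$. *)

(* Defs.v *)
From HB Require Import structures.
From mathcomp Require Import all_boot all_order all_algebra.

Set Implicit Arguments.
Unset Strict Implicit.
Unset Printing Implicit Defensive.

Import GRing.Theory.
Local Open Scope ring_scope.

(* Indices start at 0, so H_{ij} = a_{i+j-1} becomes H i j = a`_(i + j); since *)
(* i + j <= 2n - 2, the default value of nth is never used.                    *)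
Definition hankel_mx (F : finFieldType) (n : nat) (a : (2 * n - 1).-tuple F) :
  'M[F]_n := \matrix_(i < n, j < n) a`_(i + j).

Definition is_hankel_mx (F : finFieldType) (n : nat) (H : 'M[F]_n) : bool :=
  [exists a : (2 * n - 1).-tuple F, H == hankel_mx a].

(* Main.v *)
Require Import Defs.
From HB Require Import structures.
From mathcomp Require Import all_boot all_order all_algebra.
From mathcomp Require Import mxabelem zify ring.

Set Implicit Arguments.
Unset Strict Implicit.
Unset Printing Implicit Defensive.

Import GRing.Theory.
Local Open Scope ring_scope.

(* Write L_a p = \sum_l p_l a_l for the linear form on polynomials attached to *)
(* a sequence a. A vector u, read as a polynomial of degree < n, lies in the   *)
(* kernel of the Hankel matrix of a iff L_a (c u) = 0 whenever deg c < n.      *)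
(* Let V_a be this kernel and let W_a be the set of u with deg u < n - 1 and   *)
(* L_a (c u) = 0 whenever deg c < n + 1. If V_a is nonzero then W_a has        *)
(* codimension 1 in V_a, so in all cases                                       *)
(*   |V_a| + q = 1 + q |W_a| + (q - 1) [the matrix of a is singular].          *)
(* For a fixed u <> 0 the m conditions on a are independent, because           *)
(* c |-> c u is injective; this evaluates \sum_a |V_a| and \sum_a |W_a|, and   *)
(* q^(2n-2) singular matrices come out.                                        *)

(** By [card_annihilator_nontrivial], |V_a| and q |W_a| differ only when V_a = 0, where they are 1
    and q. The double count [sum_card_annihilated] gives \sum_a |V_a| = q^(2n-1) + (q^n - 1) q^(n-1)
    and q \sum_a |W_a| = q^(2n) + (q^(n-1) - 1) q^(n-1). Comparing the two sums over all q^(2n-1)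
    sequences leaves (q - 1) |S| = (q - 1) q^(2n-2), where S is the set of a with V_a nonzero
    ([card_singular_sequences]). Finally [mul_hankel_of_row] and [hankel_of_row_inj] carry the count
    over to matrices. *)

Section Counting.
Variable F : finFieldType.

(** * Cardinalities of linear sections *)

(** Each [u] in [V] is uniquely [c *: v0 + w] with [f w = 0], where [c = f u / f v0]. *)
Lemma card_hyperplane_section (n : nat) (V : {set 'rV[F]_n})
    (f : 'rV[F]_n -> F) (v0 : 'rV[F]_n) :
    (forall c u v, u \in V -> v \in V -> c *: u + v \in V) ->
    scalar f -> v0 \in V -> f v0 != 0 ->
  #|V| = (#|F| * #|[set u in V | f u == 0%R]|)%N.
Proof.
move=> Vlin flin Vv0 fv0; set W := [set u in V | _].
pose g (x : 'rV[F]_n * F) := x.2 *: v0 + x.1.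
have fg x : f (g x) = x.2 * f v0 + f x.1 by exact: flin.
have -> : V = g @: setX W setT.
  apply/setP=> u; apply/idP/imsetP => [Vu | [[w c]]].
    exists (- (f u / f v0) *: v0 + u, f u / f v0).
      by rewrite !inE /= andbT Vlin //= flin /= mulNr divfK // addNr.
    by rewrite /g /= addrA -scalerDl subrr scale0r add0r.
  by rewrite !inE /= andbT => /andP[Vw _] ->; apply: Vlin.
rewrite card_in_imset ?cardsX ?cardsT 1?mulnC //.
move=> x y; rewrite !inE /= !andbT => /andP[_ /eqP fx] /andP[_ /eqP fy] e.
have := congr1 f e; rewrite !fg fx fy !addr0 => /(mulIf fv0) cd.
by move: x y cd e {fx fy} => [u c] [v d] /= ->; rewrite /g /= => /addrI ->.
Qed.

Lemma card_left_kernel (m n : nat) (A : 'M[F]_(n, m)) :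
  #|[set u : 'rV[F]_n | u *m A == 0]| = (#|F| ^ (n - \rank A))%N.
Proof.
rewrite -mxrank_ker -card_rowg; congr #|pred_of_set _|.
by apply/setP=> u; rewrite !inE sub_kermx.
Qed.

(** * Annihilation by a linear form, and the codimension of W_a in V_a *)

Definition annihilates (m : nat) (L : {scalar {poly F}}) (p : {poly F}) : bool :=
  [forall c : 'rV[F]_m, L (rVpoly c * p) == 0].

Lemma annihilatesP m (L : {scalar {poly F}}) p :
  reflect (forall c : {poly F}, (size c <= m)%N -> L (c * p) = 0)
          (annihilates m L p).
Proof.
apply: (iffP forallP) => [h c sc | h c]; last by rewrite h ?size_poly.
by rewrite -(poly_rV_K sc); apply/eqP/h.
Qed.

Lemma annihilates_lin m (L : {scalar {poly F}}) (c : F) p r :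
  annihilates m L p -> annihilates m L r -> annihilates m L (c *: p + r).
Proof.
move=> /annihilatesP hp /annihilatesP hr; apply/annihilatesP => d sd.
by rewrite mulrDr -scalerAr linearP /= hp // hr // mulr0 addr0.
Qed.

Lemma annihilatesS m (L : {scalar {poly F}}) p :
  annihilates m.+1 L p = annihilates m L p && (L ('X^m * p) == 0).
Proof.
apply/annihilatesP/andP => [h | [/annihilatesP h /eqP hX] c sc].
  split; last by rewrite h // size_polyXn.
  by apply/annihilatesP => c sc; apply: h; apply: leqW.
rewrite -(poly_take_drop m c) mulrDl linearD /= h ?size_take_poly //.
have /size1_polyC -> : (size (drop_poly m c) <= 1)%N.
  by rewrite size_drop_poly leq_subLR addn1.
by rewrite -mulrA mul_polyC linearZ /= hX mulr0 addr0.
Qed.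

Lemma annihilates_monomials m (L : {scalar {poly F}}) p :
  reflect (forall j : 'I_m, L ('X^j * p) = 0) (annihilates m L p).
Proof.
apply: (iffP idP) => [/annihilatesP h j | h].
  by rewrite h // size_polyXn.
have {h} : forall j, (j < m)%N -> L ('X^j * p) = 0.
  by move=> j jm; apply: (h (Ordinal jm)).
elim: m => [|m IHm] h.
  apply/annihilatesP => c; rewrite leqn0 size_poly_eq0 => /eqP ->.
  by rewrite mul0r linear0.
by rewrite annihilatesS IHm ?h //= => j jm; apply/h/ltnW.
Qed.

Lemma rVpolyE n (u : 'rV[F]_n) : rVpoly u = \sum_(i < n) u 0 i *: 'X^i.
Proof.
by rewrite /rVpoly poly_def; apply: eq_bigr => i _; rewrite valK.
Qed.

Lemma rVpoly_eq0 n (u : 'rV[F]_n) : (rVpoly u == 0) = (u == 0).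
Proof. by rewrite -(can_eq rVpolyK u) linear0. Qed.

Lemma size_rVpoly n (u : 'rV[F]_n) : (size (rVpoly u) <= n)%N.
Proof. exact: size_poly. Qed.

Lemma size_rVpoly_last0 k (u : 'rV[F]_k.+1) :
  u 0 ord_max = 0 -> (size (rVpoly u) <= k)%N.
Proof.
move=> uk; apply/leq_sizeP => j; rewrite leq_eqVlt => /predU1P[<- | kj].
  exact: (etrans (coef_rVpoly_ord u ord_max) uk).
by rewrite nth_default // (leq_trans (size_rVpoly u)).
Qed.

(* The smaller set is cut out by two linear conditions, u_k = 0 and           *)
(* L (X^(k+1) u) = 0; the second follows from the first if u_k is not         *)
(* identically 0 on the larger set.                                           *)
Lemma card_annihilator_nontrivial (k : nat) (L : {scalar {poly F}})
    (u0 : 'rV[F]_k.+1) :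
    u0 != 0 -> annihilates k.+1 L (rVpoly u0) ->
  #|[set u : 'rV_k.+1 | annihilates k.+1 L (rVpoly u)]| =
  (#|F| * #|[set u : 'rV_k.+1 | (u ord0 ord_max == 0%R)
                            & annihilates k.+2 L (rVpoly u)]|)%N.
Proof.
move=> u0_neq0 annu0; set V := [set u | _].
have Vlin c u v : u \in V -> v \in V -> c *: u + v \in V.
  by rewrite !inE linearP; apply: annihilates_lin.
have [[u1 /andP[Vu1 u1k]] | topV] := altP (@existsP _ (fun u : 'rV_k.+1 =>
    (u \in V) && (u 0 ord_max != 0))).
  rewrite (@card_hyperplane_section _ V (fun u => u 0 ord_max) u1) //; last first.
    by move=> c u v; rewrite !mxE.
  congr (_ * #|pred_of_set _|)%N; apply/setP => u.
  rewrite !inE (annihilatesS k.+1).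
  have [uk | _] := eqVneq (u 0 ord_max) 0; last by rewrite andbF.
  rewrite andbT /=; case: (boolP (annihilates _ _ _)) => //= /annihilatesP annu.
  move: Vu1; rewrite inE => /annihilatesP annu1.
  suff: u1 0 ord_max * L ('X^(k.+1) * rVpoly u) = 0.
    by move/eqP; rewrite mulf_eq0 (negPf u1k) /= => ->.
  rewrite -[LHS]linearZ /=.
  (* With t the part of [u1] below degree k, [L] kills both products: X u and t X have degree at
     most k (for X u because u_k = 0), while [u1] and [u] are annihilated. *)
  have -> : u1 0 ord_max *: ('X^(k.+1) * rVpoly u) =
      ('X * rVpoly u) * rVpoly u1 - (take_poly k (rVpoly u1) * 'X) * rVpoly u.
    rewrite -{1}(poly_take_drop k (rVpoly u1)).
    have -> : drop_poly k (rVpoly u1) = (u1 0 ord_max)%:P.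
      apply/polyP => i; rewrite coef_drop_poly coefC.
      case: i => [|i]; first by rewrite -(coef_rVpoly_ord u1 ord_max).
      by rewrite nth_default // (leq_trans (size_poly _ _)) //
        addSn ltnS leq_addl.
    by rewrite -mul_polyC exprSr; ring.
  rewrite linearB /= annu1 ?annu ?subrr //.
    by rewrite (leq_trans (size_polyMleq _ _)) //
      size_polyX addn2 /= ltnS size_take_poly.
  by rewrite (leq_trans (size_polyMleq _ _)) //
    size_polyX /= ltnS size_rVpoly_last0.
have top0 u : u \in V -> u 0 ord_max = 0.
  move=> Vu; apply/eqP; apply: contraNT topV => uk; apply/existsP.
  by exists u; rewrite Vu.
have [[u1 /andP[Vu1 u1k]] | LX0] := altP (@existsP _ (fun u : 'rV_k.+1 =>
    (u \in V) && (L ('X^(k.+1) * rVpoly u) != 0))).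
  rewrite (@card_hyperplane_section _ V
            (fun u => L ('X^(k.+1) * rVpoly u)) u1) //.
    congr (_ * #|pred_of_set _|)%N; apply/setP => u.
    rewrite !inE (annihilatesS k.+1).
    case: (boolP (annihilates _ _ _)) => /= annu; last by rewrite andbF.
    by rewrite top0 ?inE // eqxx.
  by move=> c u v; rewrite linearP mulrDr -scalerAr linearP.
(* In the remaining case both functionals vanish on all of [V]; this will contradict [u0 != 0]. *)
have annX (p : {poly F}) :
    (size p <= k.+1)%N -> annihilates k.+1 L p -> annihilates k.+2 L p.
  move=> sp annp; rewrite annihilatesS annp /=.
  rewrite -(poly_rV_K sp) in annp *.
  by apply: contraNT LX0 => h; apply/existsP; exists (poly_rV p);
    rewrite inE annp.
(* As L (X^(k+1) p) = 0 too, p annihilated implies X p annihilated, and the   *)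
(* last coefficient would not vanish on a suitable X^j p.                     *)
have no_ann j (p : {poly F}) :
    p != 0 -> (size p + j = k.+1)%N -> annihilates k.+1 L p -> False.
  elim: j p => [|j IHj] p p0 sp annp.
    have sp' : (size p <= k.+1)%N by rewrite -sp addn0.
    have := @top0 (poly_rV p); rewrite inE poly_rV_K // mxE => /(_ annp).
    by rewrite -[nat_of_ord _]/k.+1.-1 -sp addn0 => /eqP;
      rewrite lead_coef_eq0 (negPf p0).
  apply: (IHj ('X * p)); rewrite ?mulf_neq0 ?polyX_eq0 //.
    by rewrite mulrC size_mulX // addSnnS.
  have /annihilatesP h : annihilates k.+2 L p by apply: annX => //; lia.
  apply/annihilatesP => c sc; rewrite mulrA h //.
  by rewrite (leq_trans (size_polyMleq _ _)) // size_polyX addn2.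
have [] := no_ann (k.+1 - size (rVpoly u0))%N (rVpoly u0) => //.
  by rewrite rVpoly_eq0.
by rewrite subnKC // size_poly.
Qed.

(** * Double counting of sequences and annihilated polynomials *)

Definition seq_form (N : nat) (a : 'rV[F]_N) (p : {poly F}) : F :=
  \sum_(l < N) p`_l * a 0 l.

Lemma seq_form_is_linear N (a : 'rV[F]_N) : scalar (seq_form a).
Proof.
move=> c p r; rewrite /seq_form mulr_sumr -big_split; apply: eq_bigr => l _ /=.
by rewrite coefD coefZ mulrDl mulrA.
Qed.

HB.instance Definition _ N (a : 'rV[F]_N) :=
  GRing.isLinear.Build F {poly F} F _ (seq_form a) (seq_form_is_linear a).

Lemma seq_formXn N (a : 'rV[F]_N) (l : 'I_N) : seq_form a 'X^l = a 0 l.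
Proof.
rewrite /seq_form (bigD1 l) //= coefXn eqxx mul1r big1 ?addr0 // => i il.
by rewrite coefXn val_eqE (negPf il) mul0r.
Qed.

(** Row j of [C] holds the coefficients of X^j p, so [c *m C] represents c p. The degree bound
    prevents truncation at [N], so [C] has rank [m], and the sequences sought form the kernel of its
    transpose. *)
Lemma card_annihilators (m N : nat) (p : {poly F}) :
    p != 0 -> (m + (size p).-1 <= N)%N ->
  #|[set a : 'rV[F]_N | annihilates m (seq_form a) p]| = (#|F| ^ (N - m))%N.
Proof.
move=> p0 le_N; pose C : 'M[F]_(m, N) := \matrix_(j, l) ('X^j * p)`_l.
have CE (c : 'rV_m) : c *m C = poly_rV (rVpoly c * p).
  apply/rowP=> l; rewrite !mxE.
  rewrite rVpolyE mulr_suml coef_sum; apply: eq_bigr => j _.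
  by rewrite mxE -scalerAl coefZ.
have rC : \rank C^T = m.
  rewrite mxrank_tr; apply/eqP; apply: inj_row_free => c.
  rewrite CE => /(congr1 rVpoly); rewrite linear0 poly_rV_K => [/eqP|].
    by rewrite mulf_eq0 (negPf p0) orbF rVpoly_eq0 => /eqP.
  rewrite (leq_trans (size_polyMleq _ _)) // (leq_trans _ le_N) //.
  by rewrite -(@prednK (size p)) ?size_poly_gt0 // addnS leq_add2r size_rVpoly.
rewrite -[in RHS]rC -card_left_kernel; congr #|pred_of_set _|; apply/setP => a.
have E (j : 'I_m) : seq_form a ('X^j * p) = (a *m C^T) 0 j.
  by rewrite mxE; apply: eq_bigr => l _; rewrite !mxE mulrC.
rewrite !inE; apply/annihilates_monomials/eqP => [h | h j].
  by apply/rowP => j; rewrite -E h mxE.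
by rewrite /= E h mxE.
Qed.

(** Exchange the sums over a and u: u = 0 is annihilated by every sequence, and each other u by q^(N
    - m) of them. *)
Lemma sum_card_annihilated (m N n : nat) (S : {set 'rV[F]_n}) :
    0 \in S ->
    (forall u, u \in S -> u != 0 -> (m + (size (rVpoly u)).-1 <= N)%N) ->
  (\sum_(a : 'rV[F]_N) #|[set u in S | annihilates m (seq_form a) (rVpoly u)]| =
  #|F| ^ N + #|S|.-1 * #|F| ^ (N - m))%N.
Proof.
move=> S0 le_N.
transitivity (\sum_(u in S)
    #|[set a : 'rV[F]_N | annihilates m (seq_form a) (rVpoly u)]|)%N.
  transitivity (\sum_(a : 'rV[F]_N) \sum_(u in S)
                   annihilates m (seq_form a) (rVpoly u))%N.
    by apply: eq_bigr => a _; rewrite -big_mkcondr sum1dep_card.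
  rewrite exchange_big /=; apply: eq_bigr => u _.
  by rewrite -big_mkcond sum1dep_card.
rewrite (bigD1 0) //=; congr (_ + _)%N.
  rewrite (_ : [set a | _] = setT) ?cardsT ?card_mx ?mul1n //.
  apply/setP => a; rewrite !inE; apply/annihilatesP => c _.
  by rewrite linear0 mulr0 linear0.
rewrite (eq_bigr (fun=> #|F| ^ (N - m))%N) => [|u /andP[Su u0]].
  rewrite sum_nat_const; congr (_ * _)%N.
  by rewrite (cardsD1 0 S) S0; apply: eq_card => u; rewrite !inE andbC.
by rewrite card_annihilators ?le_N // rVpoly_eq0.
Qed.

Lemma card_last_zero (k : nat) :
  #|[set u : 'rV[F]_k.+1 | u 0 ord_max == 0]| = (#|F| ^ k)%N.
Proof.
have q0 : (0 < #|F|)%N by apply/card_gt0P; exists 0.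
apply/eqP; rewrite -(eqn_pmul2l q0) -expnS; apply/eqP.
transitivity #|[set: 'rV[F]_k.+1]|; last by rewrite cardsT card_mx mul1n.
rewrite (@card_hyperplane_section _ setT (fun u => u 0 ord_max) (const_mx 1)) //.
- by congr (_ * _)%N; apply: eq_card => u; rewrite !inE.
- by move=> c u v; rewrite !inE.
- by move=> c u v; rewrite !mxE.
- by rewrite inE.
- by rewrite mxE oner_neq0.
Qed.

Lemma card_singular_sequences (k : nat) :
  #|[set a : 'rV[F]_(2 * k.+1 - 1) | [exists u : 'rV[F]_k.+1,
      (u != 0) && annihilates k.+1 (seq_form a) (rVpoly u)]]| =
  (#|F| ^ (2 * k))%N.
Proof.
set q := #|F|; set N := (_ - 1)%N; set S := [set a | _].
have q1 : (1 < q)%N by exact: card_finNzRing_gt1.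
pose v (a : 'rV[F]_N) :=
  #|[set u : 'rV_k.+1 in setT | annihilates k.+1 (seq_form a) (rVpoly u)]|.
pose w (a : 'rV[F]_N) :=
  #|[set u : 'rV_k.+1 in [set u : 'rV[F]_k.+1 | u ord0 ord_max == 0%R]
                        | annihilates k.+2 (seq_form a) (rVpoly u)]|.
(* Stated additively because subtraction on [nat] truncates. *)
have vw a : (v a + q = 1 + q * w a + (a \in S) * (q - 1))%N.
  rewrite inE /v /w; case: existsP => [[u0 /andP[u0_neq0 annu0]] | triv].
    have := card_annihilator_nontrivial u0_neq0 annu0; rewrite -/q => e.
    rewrite (_ : [set u in setT | _] =
        [set u : 'rV_k.+1 | annihilates k.+1 (seq_form a) (rVpoly u)]).
      rewrite e (_ : [set u in _ | _] =
          [set u : 'rV_k.+1 | (u ord0 ord_max == 0%R)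
              & annihilates k.+2 (seq_form a) (rVpoly u)]).
        by rewrite mul1n; move: (q * _)%N => x; lia.
      by apply/setP => u; rewrite !inE.
    by apply/setP => u; rewrite !inE.
  have ann_eq0 (u : 'rV_k.+1) : annihilates k.+1 (seq_form a) (rVpoly u) -> u = 0.
    by move=> h; apply/eqP; apply: contra_notT triv => u0; exists u; rewrite u0.
  have ann0 m : annihilates m (seq_form a) (rVpoly (0 : 'rV_k.+1)).
    by apply/annihilatesP => c _; rewrite linear0 mulr0 linear0.
  rewrite (_ : [set u in setT | _] = [set 0]); last first.
    by apply/setP => u; rewrite !inE /=; apply/idP/eqP => [/ann_eq0 | ->].
  rewrite (_ : [set u in _ | _] = [set 0]); last first.
    apply/setP => u; rewrite !inE; apply/andP/eqP => [[_] | ->].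
      by rewrite annihilatesS => /andP[/ann_eq0].
    by rewrite mxE eqxx.
  by rewrite !cards1; lia.
have sum_vw : (\sum_a v a + q ^ N * q =
    q ^ N + q * \sum_a w a + #|S| * (q - 1))%N.
  have sumc c : (\sum_(a : 'rV[F]_N) c = q ^ N * c)%N.
    by rewrite sum_nat_const card_mx mul1n.
  rewrite -sumc -big_split /= (eq_bigr _ (fun a _ => vw a))
    !big_split /= sumc muln1.
  by rewrite big_distrr -big_distrl /= -big_mkcond sum1_card.
(* Both degree bounds are tight: (k+1) + k = N for V_a, and (k+2) + (k-1) = N for nonzero u in W_a,
   whose lower degree pays for the extra condition. *)
move: sum_vw; rewrite !sum_card_annihilated ?inE ?mxE //; last 2 first.
- move=> u; rewrite inE => /eqP/size_rVpoly_last0 su u0.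
  rewrite addSnnS prednK ?size_poly_gt0 ?rVpoly_eq0 //.
  by rewrite (leq_trans (leq_add (leqnn _) su)) // /N; lia.
- move=> u _ _; apply: (@leq_trans (k.+1 + k)%N); last by rewrite /N; lia.
  by rewrite leq_add2l -subn1 leq_subLR add1n size_rVpoly.
rewrite cardsT card_mx mul1n card_last_zero -/q.
have NE : N = (k + k).+1 by rewrite /N; lia.
(* For k = 0 the exponent N - (k+2) truncates to 0, but the factor q^k - 1 is then 0. *)
have W : (q * ((q ^ k).-1 * q ^ (N - k.+2)) = (q ^ k).-1 * q ^ k)%N.
  rewrite NE; case: (k) => [|j] /=; first by rewrite muln0.
  by rewrite mulnCA -expnS; congr (_ * _ ^ _)%N; lia.
rewrite mulnDr W (_ : N - k.+1 = k)%N; last by rewrite NE; lia.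
move: #|S| => s; rewrite mul2n -addnn NE !expnS expnD.
have : (0 < q ^ k)%N by rewrite expn_gt0; lia.
(* Here Q = q, X = q^k and t = |S|; the equation reduces to t (Q - 1) = X^2 (Q - 1). *)
have solve Q X t : (0 < X -> 1 < Q ->
    Q * (X * X) + (Q * X).-1 * X + Q * (X * X) * Q =
    Q * (X * X) + (Q * (Q * (X * X)) + X.-1 * X) + t * (Q - 1) -> t = X * X)%N.
  case: X => // X _ Q1 e; apply/eqP; rewrite -(@eqn_pmul2r (Q - 1)) ?subn_gt0 //.
  by case: Q Q1 e => // Q _ e; apply/eqP; rewrite subn1 /=; nia.
by move=> X0; apply: solve.
Qed.

(** * From sequences to Hankel matrices *)

Definition hankel_of_row n (a : 'rV[F]_(2 * n - 1)) : 'M[F]_n :=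
  hankel_mx [tuple a 0 l | l < 2 * n - 1].

Lemma hankel_of_rowE n (a : 'rV[F]_(2 * n - 1)) (i j : 'I_n)
    (l : 'I_(2 * n - 1)) :
  (l = i + j :> nat)%N -> hankel_of_row a i j = a 0 l.
Proof. by move=> le; rewrite mxE -le nth_mktuple. Qed.

Lemma hankel_of_row_inj n : injective (@hankel_of_row n).
Proof.
move=> a b eqab; apply/rowP => l; have ln := ltn_ord l.
(* Every index l up to 2n - 2 is a sum i + j with i = min(l, n - 1), so each a_l occurs as an
   entry. *)
have [i_lt j_lt] : (minn l n.-1 < n)%N /\ (l - minn l n.-1 < n)%N by lia.
have le : (l = Ordinal i_lt + Ordinal j_lt :> nat)%N by rewrite /=; lia.
by rewrite -(hankel_of_rowE a le) eqab (hankel_of_rowE b le).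
Qed.

Lemma is_hankel_mxP n (H : 'M[F]_n) :
  reflect (exists a, H = hankel_of_row a) (is_hankel_mx H).
Proof.
apply: (iffP existsP) => [[a /eqP ->] | [a ->]]; last first.
  by exists [tuple a 0 l | l < 2 * n - 1].
exists (\row_l tnth a l); congr hankel_mx.
by apply: eq_from_tnth => l; rewrite tnth_mktuple mxE.
Qed.

(** Entry j of [u *m hankel_of_row a] is L_a (X^j u), and the monomials X^j with j < n span the
    multipliers. *)
Lemma mul_hankel_of_row n (a : 'rV[F]_(2 * n - 1)) (u : 'rV[F]_n) :
  (u *m hankel_of_row a == 0) = annihilates n (seq_form a) (rVpoly u).
Proof.
have E (j : 'I_n) : seq_form a ('X^j * rVpoly u) = (u *m hankel_of_row a) 0 j.
  rewrite rVpolyE mulr_sumr linear_sum mxE; apply: eq_bigr => i _ /=.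
  rewrite -scalerAr -exprD linearZ /=; congr (_ * _).
  have ij_lt : (i + j < 2 * n - 1)%N by have := ltn_ord i; have := ltn_ord j; lia.
  by rewrite addnC (seq_formXn a (Ordinal ij_lt))
    (@hankel_of_rowE _ _ _ _ (Ordinal ij_lt)).
apply/eqP/annihilates_monomials => [h j | h]; first by rewrite /= E h mxE.
by apply/rowP => j; rewrite -E h mxE.
Qed.

Lemma card_nonsingular_hankel (n : nat) : (1 <= n)%N ->
  #|[set H : 'M[F]_n | is_hankel_mx H & \rank H == n]|
    = (#|F| ^ (2 * n - 1) - #|F| ^ (2 * n - 2))%N.
Proof.
case: n => // k _.
pose S := [set a : 'rV[F]_(2 * k.+1 - 1) | [exists u : 'rV[F]_k.+1,
      (u != 0) && annihilates k.+1 (seq_form a) (rVpoly u)]].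
(* Full rank means trivial left kernel, so the matrices counted are the image of the complement of
   [S]. *)
transitivity #|@hankel_of_row k.+1 @: ~: S|.
  apply: eq_card => H; rewrite !inE; apply/andP/imsetP.
    case=> /is_hankel_mxP[a ->] rk; exists a => //; rewrite !inE negb_exists.
    apply/forallP => u; rewrite -mul_hankel_of_row.
    by rewrite mulmx_free_eq0 // andNb.
  case=> a; rewrite !inE => aS ->; split; first by apply/is_hankel_mxP; exists a.
  apply: inj_row_free => u /eqP; rewrite mul_hankel_of_row => annu.
  apply/eqP; apply: contraNT aS => u0; apply/existsP.
  by exists u; rewrite u0.
rewrite card_imset; last exact: hankel_of_row_inj.
rewrite cardsCs setCK card_mx mul1n card_singular_sequences.
by congr (_ - _ ^ _)%N; lia.
Qed.

End Counting.

Theorem theorem5p2 (F : finFieldType) (q n : nat) (hq : #|F| = q)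
    (hn : (1 <= n)%N) :
  #|[set H : 'M[F]_n | is_hankel_mx H & \rank H == n]|
    = (q ^ (2 * n - 1) - q ^ (2 * n - 2))%N.
Proof. by rewrite -hq; apply: card_nonsingular_hankel. Qed.
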